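(* Let $K\ge 2$ be an integer and $\alpha\in\mathbb{R}$. Let $C_{\alpha,K}$ denote the largest $C\ge 0$ such that for every $p,q\in\operatorname{relint}(\Delta^K)$, \[ D_\alpha(p\Vert q)\ \ge\ \frac{C}{2}\,\|p-q\|_1^2 . \] Then \[ C_{\alpha,K}=\begin{cases} 2^{1-\alpha} & \text{if } \alpha\in(-\infty,1],\\ K^{1-\alpha} & \text{if } \alpha\in(1,2] \text{ and } K \text{ is even},\\ K^{1-\alpha}\cdot \sigma_{\alpha,K} & \text{if } \alpha\in(1,2] \text{ and } K \text{ is odd},\\ 2^{1-\max\{\alpha,3\}} & \text{if } \alpha\in(2,+\infty) \text{ and } K=2,\\ 0 & \text{if } \alpha\in(2,+\infty) \text{ and } K\ge 3, \end{cases} \] where \[ \sigma_{\alpha,K}:=\left(\frac{\left(1-\frac1K\right)^{\frac{1-\alpha}{3-\alpha}}+\left(1+\frac1K\right)^{\frac{1-\alpha}{3-\alpha}}}{2}\right)^{3-\alpha}. \]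
   Context: $\Delta^K=\{p\in[0,1]^K:\sum_{k=1}^K p_k=1\}$ is the probability simplex and $\operatorname{relint}(\Delta^K)=\Delta^K\cap(0,1)^K$. For $\alpha\in\mathbb{R}$ and $p\in(0,+\infty)^K$, the $\alpha$-Tsallis entropy is $S_\alpha(p)=\frac{\sum_{k=1}^K p_k^\alpha}{\alpha(1-\alpha)}$ if $\alpha\notin\{0,1\}$, $S_0(p)=\sum_{k=1}^K\ln p_k$, and $S_1(p)=-\sum_{k=1}^K p_k\ln p_k$. For $p,q\in(0,+\infty)^K$, $D_\alpha(p\Vert q)$ is the Bregman divergence of $-S_\alpha$: $D_\alpha(p\Vert q)=-S_\alpha(p)+S_\alpha(q)+\langle\nabla S_\alpha(q),p-q\rangle$. Explicitly, $D_\alpha(p\Vert q)=\frac1\alpha\sum_k\frac{p_k^\alpha+(\alpha-1)q_k^\alpha-\alpha p_kq_k^{\alpha-1}}{\alpha-1}$ for $\alpha\notin\{0,1\}$, $D_0(p\Vert q)=\sum_k\big(\frac{p_k}{q_k}-\ln\frac{p_k}{q_k}-1\big)$, and $D_1(p\Vert q)=\sum_k\big(p_k\ln\frac{p_k}{q_k}-p_k+q_k\big)$. $\|x\|_1=\sum_k|x_k|$. *)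

(* Defs.v *)
From mathcomp Require Import all_boot all_order all_algebra.
From mathcomp Require Import all_classical all_reals all_analysis.
Set Implicit Arguments. Unset Strict Implicit. Unset Printing Implicit Defensive.
Import Order.TTheory GRing.Theory Num.Theory.
Local Open Scope ring_scope.

Section Defs.
Variable R : realType.

Definition relint_simplex (K : nat) (p : 'I_K -> R) : Prop :=
  (forall k, 0 < p k < 1) /\ \sum_(k < K) p k = 1.

(* alpha-Tsallis entropy (for p with positive entries) *)
Definition tsallis (K : nat) (a : R) (p : 'I_K -> R) : R :=
  if a == 0 then \sum_(k < K) ln (p k)
  else if a == 1 then - \sum_(k < K) p k * ln (p k)
  else (\sum_(k < K) p k `^ a) / (a * (1 - a)).

(* Bregman divergence D_alpha(p || q) of -S_alpha, explicit form *)
Definition tsallis_div (K : nat) (a : R) (p q : 'I_K -> R) : R :=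
  if a == 0 then \sum_(k < K) (p k / q k - ln (p k / q k) - 1)
  else if a == 1 then \sum_(k < K) (p k * ln (p k / q k) - p k + q k)
  else a^-1 * \sum_(k < K)
         ((p k `^ a + (a - 1) * q k `^ a - a * p k * q k `^ (a - 1)) / (a - 1)).

Definition norm1 (K : nat) (x : 'I_K -> R) : R := \sum_(k < K) `|x k|.

Definition admissible_const (K : nat) (a C : R) : Prop :=
  0 <= C /\
  forall p q : 'I_K -> R, relint_simplex p -> relint_simplex q ->
    tsallis_div a p q >= C / 2 * (norm1 (fun k => p k - q k)) ^+ 2.

Definition sigma_const (a : R) (K : nat) : R :=
  (((1 - K%:R^-1) `^ ((1 - a) / (3 - a)) + (1 + K%:R^-1) `^ ((1 - a) / (3 - a))) / 2)
    `^ (3 - a).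

Definition C_value (a : R) (K : nat) : R :=
  if a <= 1 then 2 `^ (1 - a)
  else if a <= 2 then
    (if odd K then K%:R `^ (1 - a) * sigma_const a K else K%:R `^ (1 - a))
  else if K == 2%N then 2 `^ (1 - Num.max a 3)
  else 0.

End Defs.

(* Main.v *)
(*
Writing the divergence along the segment from q to p and differentiating twice
turns admissibility of C into the pointwise Hessian inequality
C |v|_1^2 <= sum_k x_k^(a-2) v_k^2 for x in the open simplex and sum_k v_k = 0.
Split the indices into P = {v > 0} and its complement; v has the same mass
|v|_1 / 2 on both parts, so Cauchy-Schwarz bounds the Hessian form below by
|v|_1^2 / 4 times the sum over the two parts of 1 / sum x_k^(2-a).
For a <= 1 superadditivity of t^(2-a) and convexity of t^(a-2) finish.
For 1 < a <= 2 concavity of t^(2-a) brings in the sizes m, n of the two parts,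
Radon's inequality gives (m^b + n^b)^(3-a) with b = (1-a)/(3-a) <= 0, and
convexity of t^b makes the balanced split the worst one.
Two-valued x and v show that the constants are sharp; for a <= 1 with K >= 3,
and for a > 2 except when K = 2 and a >= 3, the infimum is only approached at
the boundary of the simplex.
*)
Require Import Defs.
From mathcomp Require Import all_boot all_order all_algebra.
From mathcomp Require Import all_classical all_reals all_analysis.
From mathcomp Require Import ring lra zify.
Import Order.TTheory GRing.Theory Num.Theory.
Import numFieldNormedType.Exports.
Local Open Scope ring_scope.

Set Implicit Arguments. Unset Strict Implicit. Unset Printing Implicit Defensive.

(** * Second-order calculus on segments and the scalar power potentials *)

Section Calculus.
Variable R : realType.
Implicit Types (a x y t v : R) (f : R -> R).

Lemma MVT_derive_segment f (df : R -> R) (T : R) :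
  0 <= T -> (forall t, 0 <= t <= T -> is_derive t 1 f (df t)) ->
  exists2 c, 0 <= c <= T & f T - f 0 = df c * T.
Proof.
move=> T0 fd.
have [||c cT ->] := @MVT_segment R f df 0 T T0.
- by move=> x; rewrite in_itv/= => /andP[? ?]; apply: fd; rewrite !ltW.
- apply: derivable_within_continuous => x; rewrite in_itv/= => xT.
  by have [] := fd x xT.
- by exists c; rewrite ?subr0//; move: cT; rewrite in_itv.
Qed.

(** The mean value theorem used twice: [f T = df c * T], then [df c = ddf e * c] with
    [0 <= e <= c]. *)
Lemma ge0_of_second_derive f (df ddf : R -> R) (T : R) : 0 <= T ->
  (forall t, 0 <= t <= T -> is_derive t 1 f (df t)) ->
  (forall t, 0 <= t <= T -> is_derive t 1 df (ddf t)) ->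
  (forall t, 0 <= t <= T -> 0 <= ddf t) ->
  f 0 = 0 -> df 0 = 0 -> 0 <= f T.
Proof.
move=> T0 fd dfd dd0 f0 df0.
have [c /andP[c0 cT]] := MVT_derive_segment T0 fd.
rewrite f0 subr0 => ->; apply: mulr_ge0 => //.
have sub t : 0 <= t <= c -> 0 <= t <= T.
  by move=> /andP[-> tc]; rewrite (le_trans tc).
have [e e0c] := MVT_derive_segment c0 (fun t tc => dfd t (sub t tc)).
by rewrite df0 subr0 => ->; apply: mulr_ge0 => //; apply/dd0/sub.
Qed.

Lemma is_deriveMr f c x (df : R) :
  is_derive x 1 f df -> is_derive x 1 (fun y => f y * c) (df * c).
Proof.
move=> fd; have -> : (fun y => f y * c) = c \*: f.
  by apply/funext => y; rewrite /= mulrC.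
by rewrite (mulrC df); exact: is_deriveZ.
Qed.

Lemma is_derive_line f x v t (df : R) :
  is_derive (x + t * v) 1 f df -> is_derive t 1 (fun u => f (x + u * v)) (df * v).
Proof.
move=> fd; apply: (@is_derive1_comp _ f (fun u => x + u * v)).
have -> : (fun u => x + u * v) = cst x + (v \*: id).
  by apply/funext => u; rewrite /= mulrC.
by apply: is_derive_eq; rewrite add0r; exact: mulr1.
Qed.

(** The scalar summand of [-S_a], up to the linear term [- x] at [a = 1]. That term does not affect
    Bregman divergences and makes the derivative exactly [ln x]; the second derivative is [x^(a-2)]
    in all three cases. *)
Definition pot a x : R :=
  if a == 0 then - ln x else if a == 1 then x * ln x - x
  else x `^ a / (a * (a - 1)).

Definition dpot a x : R := if a == 1 then ln x else x `^ (a - 1) / (a - 1).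

Lemma is_derive_dpot a x : 0 < x -> is_derive x 1 (dpot a) (x `^ (a - 2)).
Proof.
move=> x0; rewrite /dpot; case: eqVneq => [->|a1].
  have -> : 1 - 2 = - 1 :> R by lra.
  by rewrite powR_inv1 ?ltW//; apply: is_derive1_ln.
have a10 : a - 1 != 0 by rewrite subr_eq0.
apply: is_derive_eq; first by apply: is_deriveMr; exact: is_derive1_powR.
have -> : a - 2 = a - 1 - 1 by lra.
by rewrite mulrAC divff// mul1r.
Qed.

Lemma is_derive_pot a x : 0 < x -> is_derive x 1 (pot a) (dpot a x).
Proof.
move=> x0; rewrite /pot /dpot; case: eqVneq => [->|a0].
  rewrite eq_sym oner_eq0.
  apply: is_derive_eq; first exact: is_deriveN (is_derive1_ln x0).
  by rewrite sub0r powR_inv1 ?ltW// invrN1 mulrN1.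
case: eqVneq => [_|a1].
  have -> : (fun y => y * ln y - y) = (id * @ln R) - id by [].
  apply: is_derive_eq.
    by apply: is_deriveB; apply: is_deriveM; exact: is_derive1_ln.
  by rewrite /GRing.scale/= divff ?gt_eqF// mulr1 addrC addKr.
have a10 : a - 1 != 0 by rewrite subr_eq0.
apply: is_derive_eq; first by apply: is_deriveMr; exact: is_derive1_powR.
by field; rewrite a0 a10.
Qed.

Lemma segment_gt0 x y t : 0 < x -> 0 < y -> 0 <= t <= 1 -> 0 < y + t * (x - y).
Proof. by move=> x0 y0 /andP[t0 t1]; nra. Qed.

(** Convexity of [pot a]: the gap to the tangent vanishes to first order at [y] and has second
    derivative [x^(a-2) v^2 >= 0] along the segment. The tangent-line bounds for powers all come
    from here. *)
Lemma pot_tangent a x y : 0 < x -> 0 < y ->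
  pot a y + dpot a y * (x - y) <= pot a x.
Proof.
move=> x0 y0.
pose v := x - y.
have pos t : 0 <= t <= 1 -> 0 < y + t * v.
  exact: segment_gt0.
pose f t := pot a (y + t * v) - (pot a y + (dpot a y * v) * t).
suff : 0 <= f 1.
  by rewrite /f mul1r mulr1 /v subrKC subr_ge0.
apply: (@ge0_of_second_derive f
  (fun t => dpot a (y + t * v) * v - dpot a y * v)
  (fun t => (y + t * v) `^ (a - 2) * v * v)) => [|t t01|t t01|t t01||]; first exact: ler01.
- apply: is_deriveB; first exact/is_derive_line/is_derive_pot/pos.
  have -> : (fun u : R => pot a y + (dpot a y * v) * u) =
    cst (pot a y) + (dpot a y * v) \*: id by [].
  by apply: is_derive_eq; rewrite add0r; exact: mulr1.
- rewrite -[X in is_derive _ _ _ X]subr0.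
  apply: is_deriveB; apply: is_deriveMr.
  exact/is_derive_line/is_derive_dpot/pos.
- by rewrite -mulrA mulr_ge0 ?powR_ge0// -expr2 sqr_ge0.
- by rewrite /f mul0r mulr0 !addr0 subrr.
- by rewrite mul0r addr0 subrr.
Qed.

End Calculus.

(** * Admissibility of a constant is equivalent to a pointwise Hessian inequality *)

Section SecondOrder.
Local Open Scope classical_set_scope.
Variables (R : realType) (K : nat) (a : R).
Implicit Types (p q x v : 'I_K -> R) (t C : R).

Definition hess x v : R := \sum_(k < K) x k `^ (a - 2) * v k ^+ 2.

Definition bregman p q : R :=
  \sum_(k < K) (pot a (p k) - pot a (q k) - dpot a (q k) * (p k - q k)).

Lemma tsallis_divE p q : (forall k, 0 < p k) -> (forall k, 0 < q k) ->
  tsallis_div a p q = bregman p q.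
Proof.
move=> p0 q0; rewrite /tsallis_div /bregman /pot /dpot.
case: eqVneq => [->|a0].
  rewrite eq_sym oner_eq0; apply: eq_bigr => k _.
  rewrite ln_div ?posrE// sub0r powR_inv1 ?ltW// invrN1.
  by have := gt_eqF (q0 k) => /negbT qk0; field.
case: eqVneq => [_|a1].
  by apply: eq_bigr => k _; rewrite ln_div ?posrE//; ring.
have a10 : a - 1 != 0 by rewrite subr_eq0.
rewrite mulr_sumr; apply: eq_bigr => k _.
have -> : q k `^ a = q k * q k `^ (a - 1).
  rewrite -{2}(powRr1 (ltW (q0 k))) -powRD ?subrKC//.
  by rewrite (gt_eqF (q0 k)) implybT.
by field; rewrite a0 a10.
Qed.

Lemma is_derive_bregman_line q v t : (forall k, 0 < q k + t * v k) ->
  is_derive t 1 (fun u => bregman (fun k => q k + u * v k) q)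
    (\sum_(k < K) (dpot a (q k + t * v k) - dpot a (q k)) * v k).
Proof.
move=> pos.
have -> : (fun u => bregman (fun k => q k + u * v k) q) =
  \sum_(k < K) (fun u => pot a (q k + u * v k) - pot a (q k) - u * (dpot a (q k) * v k)).
  apply/funext => u; rewrite fct_sumE /bregman; apply: eq_bigr => k _.
  by ring.
apply: is_derive_sum => k; rewrite mulrBl.
apply: is_deriveB; last first.
  by rewrite -[X in is_derive _ _ _ X]mul1r; apply: is_deriveMr.
rewrite -[X in is_derive _ _ _ X]subr0; apply: is_deriveB.
by apply/is_derive_line/is_derive_pot/pos.
Qed.

Lemma is_derive_hess_line q v t : (forall k, 0 < q k + t * v k) ->
  is_derive t 1 (fun u => \sum_(k < K) (dpot a (q k + u * v k) - dpot a (q k)) * v k)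
    (hess (fun k => q k + t * v k) v).
Proof.
move=> pos.
have -> : (fun u => \sum_(k < K) (dpot a (q k + u * v k) - dpot a (q k)) * v k) =
  \sum_(k < K) (fun u => (dpot a (q k + u * v k) - dpot a (q k)) * v k).
  by apply/funext => u; rewrite fct_sumE.
apply: is_derive_sum => k; rewrite expr2 mulrA; apply: is_deriveMr.
rewrite -[X in is_derive _ _ _ X]subr0; apply: is_deriveB.
exact/is_derive_line/is_derive_dpot/pos.
Qed.

(** A constant bound [M] on the Hessian form along a segment integrates twice to [M / 2 * T^2]. The
    sign [e] lets one proof serve both directions: [e = 1] yields the lower bound on the divergence
    and [e = -1] the upper bound. *)
Lemma bregman_line_ge0 q v (e M T : R) : 0 <= T ->
  (forall t, 0 <= t <= T -> forall k, 0 < q k + t * v k) ->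
  (forall t, 0 <= t <= T -> 0 <= e * (hess (fun k => q k + t * v k) v - M)) ->
  0 <= e * (bregman (fun k => q k + T * v k) q - M / 2 * T ^+ 2).
Proof.
move=> T0 pos le0.
pose f u := (bregman (fun k => q k + u * v k) q - u * u * (M / 2)) * e.
suff : 0 <= f T by rewrite /f mulrC -expr2 [_ * (M / 2)]mulrC.
pose df u :=
  (\sum_(k < K) (dpot a (q k + u * v k) - dpot a (q k)) * v k - u * M) * e.
pose ddf u := (hess (fun k => q k + u * v k) v - M) * e.
apply: (@ge0_of_second_derive _ f df ddf) => // [t tT|t tT|t tT||].
- apply: is_deriveMr; apply: is_deriveB; first exact/is_derive_bregman_line/pos.
  (* This is the shape that the product rule gives for the derivative of [u * u * (M / 2)]. *)
  have -> : t * M = (t *: 1 + t *: 1) * (M / 2).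
    by rewrite /GRing.scale/=; field.
  exact: is_deriveMr.
- apply: is_deriveMr; apply: is_deriveB; first exact/is_derive_hess_line/pos.
  by rewrite -[X in is_derive _ _ _ X]mul1r; apply: is_deriveMr.
- by rewrite /ddf mulrC le0.
- rewrite /f !mul0r subr0 /bregman big1 ?mul0r// => k _.
  by rewrite mul0r addr0 !subrr mulr0 subr0.
- rewrite /df !mul0r subr0 big1 ?mul0r// => k _.
  by rewrite mul0r addr0 subrr mul0r.
Qed.

Definition hess_bound C : Prop := forall x v, relint_simplex x ->
  \sum_(k < K) v k = 0 -> C * norm1 v ^+ 2 <= hess x v.

Lemma admissible_of_hess_bound C : 0 <= C -> hess_bound C -> admissible_const K a C.
Proof.
move=> C0 HC; split=> // p q [p01 p1] [q01 q1].
have p0 k : 0 < p k by case/andP: (p01 k).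
have q0 k : 0 < q k by case/andP: (q01 k).
rewrite tsallis_divE//.
pose v k := p k - q k.
have v0 : \sum_(k < K) v k = 0 by rewrite sumrB p1 q1 subrr.
have qp : (fun k => q k + 1 * v k) = p.
  by apply/funext => k; rewrite mul1r /v subrKC.
have := @bregman_line_ge0 q v 1 (C * norm1 v ^+ 2) 1 ler01.
rewrite qp mul1r expr1n mulr1 subr_ge0 mulrAC; apply => t t01.
  by move=> k; exact: segment_gt0.
rewrite mul1r subr_ge0; apply: HC => //; split; last first.
  by rewrite big_split/= -mulr_sumr v0 mulr0 addr0.
move=> k; rewrite segment_gt0//=.
(* The upper bound by 1 is positivity of the segment between the complements [1 - q k] and
   [1 - p k]. *)
have -> : q k + t * v k = 1 - ((1 - q k) + t * ((1 - p k) - (1 - q k))).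
  by rewrite /v; ring.
rewrite ltrBlDr ltrDl segment_gt0// subr_gt0.
  by case/andP: (p01 k).
by case/andP: (q01 k).
Qed.

(** By contradiction: a strict violation at [q] persists, by continuity, on a short segment from [q]
    in direction [v]. The divergence at its endpoint is then too small for [C]. *)
Lemma hess_bound_of_admissible C : admissible_const K a C -> hess_bound C.
Proof.
move=> [C0 HC] q v [q01 q1] v0; rewrite leNgt; apply/negP => ltC.
have q0 k : 0 < q k by case/andP: (q01 k).
(* The midpoint leaves room on both sides: the Hessian form stays below [M] near [q], and [M] is
   still strictly below [C * norm1 v ^+ 2]. *)
set M := (hess q v + C * norm1 v ^+ 2) / 2.
have ltM : hess q v < M by rewrite /M; lra.
have line_cont k : (q k + t * v k) @[t --> (0 : R)] --> q k.
  rewrite -[X in _ --> X](addr0) -[X in _ --> _ + X](mul0r (v k)).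
  by apply: cvgD; [exact: cvg_cst | apply: cvgMl; exact: cvg_id].
have hess_cont : hess (fun k => q k + t * v k) v @[t --> (0 : R)] --> hess q v.
  rewrite /hess; apply: cvg_big => [|k _]; [exact: add_continuous|apply: cvgMl].
  have : {for q k, continuous (fun y : R => y `^ (a - 2))}.
    have [dq _] := is_derive1_powR (a - 2) (q0 k).
    by apply: differentiable_continuous; apply/derivable1_diffP.
  by move=> pc; exact: cvg_comp (line_cont k) pc.
have near0 : \forall t \near (0 : R),
    (forall k, 0 < q k + t * v k < 1) /\ hess (fun k => q k + t * v k) v < M.
  have nbd1 : \forall t \near (0 : R), forall k, 0 < q k + t * v k < 1.
    apply: (@filter_forall R _ (fun k t => 0 < q k + t * v k < 1) (nbhs (0 : R)) _) => k.
    apply: (line_cont k [set y | 0 < y < 1]).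
    have qk : q k \in `]0, 1[%R by rewrite in_itv; exact: q01.
    by have := near_in_itvoo qk; apply: filterS => y; rewrite in_itv.
  have nbd2 := cvgr_lt _ hess_cont _ ltM.
  by near=> t; split; [near: t; exact: nbd1 | near: t; exact: nbd2].
have [T T0 {near0}HT] : exists2 T, 0 < T & forall t, 0 <= t <= T ->
    (forall k, 0 < q k + t * v k < 1) /\ hess (fun k => q k + t * v k) v < M.
  have /nbhs_ballP[e /= e0 He] := near0.
  exists (e / 2); first by rewrite divr_gt0.
  move=> t /andP[t0 te]; apply: He; rewrite /ball/= sub0r normrN ger0_norm//.
  by lra.
have TT : 0 <= T <= T by rewrite ltW/=.
have [p01 _] := HT T TT.
have p1 : \sum_(k < K) (q k + T * v k) = 1.
  by rewrite big_split/= -mulr_sumr v0 q1 mulr0 addr0.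
have := HC _ _ (conj p01 p1) (conj q01 q1).
rewrite tsallis_divE// => [|k]; last by case/andP: (p01 k).
have := @bregman_line_ge0 q v (-1) M T (ltW T0).
have -> : norm1 (fun k => q k + T * v k - q k) = T * norm1 v.
  rewrite /norm1 mulr_sumr; apply: eq_bigr => k _.
  by rewrite addrC addKr normrM gtr0_norm.
move=> H1 H2.
have {}H1 : bregman (fun k => q k + T * v k) q <= M / 2 * T ^+ 2.
  rewrite -subr_le0 -oppr_ge0 -mulN1r; apply: H1 => t /HT[tk hM].
    by move=> k; case/andP: (tk k).
  by rewrite mulN1r oppr_ge0 subr_le0 ltW.
have := le_trans H2 H1; rewrite exprMn.
have -> : C / 2 * (T ^+ 2 * norm1 v ^+ 2) = (C * norm1 v ^+ 2) / 2 * T ^+ 2 by ring.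
rewrite ler_pM2r ?exprn_gt0// ler_pM2r ?invr_gt0//.
by rewrite leNgt /M; move/negP; apply; lra.
Unshelve. all: by end_near. Qed.

End SecondOrder.

(** * Convexity, Radon and power-mean inequalities for real powers *)

Section PowerInequalities.
Variable R : realType.
Implicit Types (a b x y : R).

(** The sign of [b * (b - 1)] decides between convexity and concavity, so both tangent bounds are
    read off from this one. *)
Lemma powR_tangent b x y : b != 0 -> b != 1 -> 0 < x -> 0 < y ->
  0 <= (x `^ b - (y `^ b + b * y `^ (b - 1) * (x - y))) / (b * (b - 1)).
Proof.
move=> b0 b1 x0 y0; have b10 : b - 1 != 0 by rewrite subr_eq0.
have := pot_tangent b x0 y0; rewrite /pot /dpot (negbTE b0) (negbTE b1).
rewrite -subr_ge0; congr (0 <= _); field.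
by rewrite b0 b10.
Qed.

Lemma powR_tangent_convex b x y : b <= 0 \/ 1 <= b -> 0 < x -> 0 < y ->
  y `^ b + b * y `^ (b - 1) * (x - y) <= x `^ b.
Proof.
move=> hb x0 y0.
have [->|b0] := eqVneq b 0; first by rewrite !powRr0 !mul0r addr0.
have [->|b1] := eqVneq b 1; first by rewrite subrr powRr0 (powRr1 (ltW x0)) (powRr1 (ltW y0)) !mul1r subrKC.
have := powR_tangent b0 b1 x0 y0.
rewrite pmulr_lge0 ?subr_ge0// invr_gt0.
case: hb => hb.
  by have {}b0 : b < 0 by [rewrite lt_neqAle b0]; nra.
by have {}b1 : 1 < b by [rewrite lt_neqAle eq_sym b1]; nra.
Qed.

Lemma powR_tangent_concave b x y : 0 <= b <= 1 -> 0 < x -> 0 < y ->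
  x `^ b <= y `^ b + b * y `^ (b - 1) * (x - y).
Proof.
move=> /andP[b_ge0 b_le1] x0 y0.
have [->|b0] := eqVneq b 0; first by rewrite !powRr0 !mul0r addr0.
have [->|b1] := eqVneq b 1; first by rewrite subrr powRr0 (powRr1 (ltW x0)) (powRr1 (ltW y0)) !mul1r subrKC.
have := powR_tangent b0 b1 x0 y0.
rewrite nmulr_lge0 ?subr_le0// invr_lt0.
have {}b0 : 0 < b by rewrite lt_neqAle eq_sym b0.
have {}b1 : b < 1 by rewrite lt_neqAle b1.
by nra.
Qed.

(** Identifies [4 * C] for [C = 2^(1-b)] with the value of [x^(b-2) + y^(b-2)] at [x = y = 1/2]. *)
Lemma powR2_quadruple b : 2 `^ (1 - (b - 2)) = 4 * 2 `^ (1 - b) :> R.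
Proof.
have -> : 1 - (b - 2) = 2 + (1 - b) by lra.
by rewrite powRD ?pnatr_eq0 ?implybT// powR_mulrn// -natrX.
Qed.

Lemma powR_half_double b : 2^-1 `^ b + 2^-1 `^ b = 2 `^ (1 - b) :> R.
Proof.
rewrite powRD ?pnatr_eq0 ?implybT// powRr1// -[2^-1 in LHS]powR_inv1//.
by rewrite -powRrM mulN1r; ring.
Qed.

(** Add the tangent bounds at [1/2]; the linear terms cancel because [x + y = 1]. *)
Lemma le_sum_powR_half b x y : b <= 0 \/ 1 <= b -> 0 < x -> 0 < y -> x + y = 1 ->
  2 `^ (1 - b) <= x `^ b + y `^ b.
Proof.
move=> hb x0 y0 xy.
have h0 : 0 < 2^-1 :> R by rewrite invr_gt0.
have := powR_tangent_convex hb x0 h0; have := powR_tangent_convex hb y0 h0.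
rewrite -powR_half_double.
move: (2^-1 `^ b) => u; move: (b * _) => w.
have -> : y = 1 - x by lra.
by nra.
Qed.

(** Jensen for [t^r] with weights [x], [y] at the points [A / x], [B / y], whose weighted mean is
    [A + B]: each right-hand term is [x * (A / x)^r] in disguise. *)
Lemma radon_powR r x y A B : 1 <= r -> 0 < x -> 0 < y -> x + y = 1 ->
  0 < A -> 0 < B ->
  (A + B) `^ r <= A `^ r * x `^ (1 - r) + B `^ r * y `^ (1 - r).
Proof.
move=> r1 x0 y0 xy A0 B0.
have r1' : r <= 0 \/ 1 <= r by right.
have homog z D : 0 < z -> 0 < D -> D `^ r * z `^ (1 - r) = z * (D / z) `^ r.
  move=> z0 D0; rewrite powRM ?invr_ge0 ?ltW// -[z^-1]powR_inv1 ?ltW//.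
  rewrite -powRrM mulN1r powRD ?(gt_eqF z0) ?implybT// powRr1 ?ltW//.
  by rewrite mulrCA.
rewrite !homog//.
have AB : 0 < A + B by rewrite addr_gt0.
have hA := powR_tangent_convex r1' (divr_gt0 A0 x0) AB.
have hB := powR_tangent_convex r1' (divr_gt0 B0 y0) AB.
rewrite -(ler_pM2l x0) in hA; rewrite -(ler_pM2l y0) in hB.
have := lerD hA hB; apply: le_trans.
move: (_ `^ r) => u; move: (r * _) => w.
have -> : x * (u + w * (A / x - (A + B))) + y * (u + w * (B / y - (A + B)))
  = (x + y) * u + w * (A + B - (x + y) * (A + B)).
  by field; rewrite !gt_eqF.
by rewrite xy !mul1r subrr mulr0 addr0.
Qed.

Variable I : finType.
Implicit Types (P : pred I) (z : I -> R).

Lemma sum_gt0 P z : (forall i, 0 < z i) -> (exists i, P i) -> 0 < \sum_(i | P i) z i.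
Proof.
move=> z0 [i Pi]; rewrite (bigD1 i)//= ltr_pwDl// sumr_ge0// => j _.
exact: ltW.
Qed.

(** Write [z^b = z * z^(b-1)] and bound the second factor by the same power of the whole sum. *)
Lemma sum_powR_le P z b : 1 <= b -> (forall i, 0 < z i) ->
  \sum_(i | P i) z i `^ b <= (\sum_(i | P i) z i) `^ b.
Proof.
move=> b1 z0; have b0 : 0 < b by rewrite (lt_le_trans ltr01).
rewrite -mulr_powRB1//; last by apply: sumr_ge0 => i _; exact: ltW.
rewrite mulr_suml; apply: ler_sum => i Pi.
rewrite -(mulr_powRB1 (ltW (z0 i)) b0) ler_wpM2l ?(ltW (z0 i))//.
apply: ge0_ler_powR; rewrite ?subr_ge0 ?nnegrE//; first exact: ltW.
  by apply: sumr_ge0 => j _; exact: ltW.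
rewrite (bigD1 i)//= lerDl; apply: sumr_ge0 => j _; exact: ltW.
Qed.

(** Sum the concave tangent bounds at the mean [X / m], where the linear terms cancel. *)
Lemma sum_powR_card_le P z b : 0 <= b <= 1 -> (forall i, 0 < z i) ->
  (exists i, P i) ->
  \sum_(i | P i) z i `^ b <= #|P|%:R `^ (1 - b) * (\sum_(i | P i) z i) `^ b.
Proof.
move=> b01 z0 exP; have X0 := sum_gt0 z0 exP.
set X := \sum_(i | P i) z i in X0 *.
have m0 : 0 < #|P|%:R :> R.
  by case: exP => i Pi; rewrite ltr0n; apply/card_gt0P; exists i.
set m : R := #|P|%:R in m0 *.
have mu0 : 0 < X / m by rewrite divr_gt0.
apply: le_trans (ler_sum _ (fun i _ => powR_tangent_concave b01 (z0 i) mu0)) _.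
rewrite big_split/= -mulr_sumr sumrB -/X !sumr_const.
rewrite -(mulr_natr (_ `^ b)) -(mulr_natr (X / m)) -/m.
rewrite divfK ?gt_eqF// subrr mulr0 addr0.
rewrite powRM ?invr_ge0 ?(ltW X0) ?(ltW m0)// -[m^-1](powR_inv1 (ltW m0)).
rewrite -powRrM mulN1r powRD ?(gt_eqF m0) ?implybT// (powRr1 (ltW m0)).
by rewrite le_eqVlt; apply/orP; left; apply/eqP; ring.
Qed.

End PowerInequalities.

(** * Reduction of the Hessian inequality to two-part splits, and the case [a <= 1] *)

Section LowerBounds.
Variables (R : realType) (K : nat) (a : R).
Implicit Types (x v : 'I_K -> R) (P : pred 'I_K) (C : R).

Lemma hess_partition x v P : (forall k, 0 < x k) -> (exists k, P k) ->
  (\sum_(k | P k) `|v k|) ^+ 2 * (\sum_(k | P k) x k `^ (2 - a))^-1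
    <= \sum_(k | P k) x k `^ (a - 2) * v k ^+ 2.
Proof.
move=> x0 exP; set S := \sum_(k | P k) `|v k|.
set G := \sum_(k | P k) x k `^ (2 - a).
have G0 : 0 < G by apply: sum_gt0 => // k; rewrite powR_gt0.
(* Cauchy-Schwarz by completing squares: with the optimal multiplier [l = S / G], the difference of
   the two sides becomes a sum of terms [u * (|v k| - l / u)^2]. *)
have -> : S ^+ 2 * G^-1 = 2 * (S / G) * S - (S / G) ^+ 2 * G.
  by field; rewrite gt_eqF.
rewrite /S /G; rewrite !mulr_sumr -sumrB -/S -/G; apply: ler_sum => k _.
have -> : 2 - a = - (a - 2) by rewrite opprB.
rewrite powRN; have : 0 < x k `^ (a - 2) by rewrite powR_gt0.
move: (_ `^ _) (S / G) => u l u0; rewrite -[v k ^+ 2]real_normK ?num_real//.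
rewrite -subr_ge0.
have -> : u * `|v k| ^+ 2 - (2 * l * `|v k| - l ^+ 2 * u^-1) = u * (`|v k| - l / u) ^+ 2.
  by field; rewrite gt_eqF.
by rewrite mulr_ge0 ?sqr_ge0// ltW.
Qed.

(** The factor 4 arises from [norm1 v = 2 * S], where [S] is the mass of [v] on either part. When
    [S = 0] the claim is trivial; otherwise neither part is empty. *)
Lemma hess_bound_of_partition C :
  (forall x P, relint_simplex x -> (exists k, P k) -> (exists k, ~~ P k) ->
    4 * C <= (\sum_(k | P k) x k `^ (2 - a))^-1
           + (\sum_(k | ~~ P k) x k `^ (2 - a))^-1) ->
  hess_bound K a C.
Proof.
move=> HC x v xs v0.
have x0 k : 0 < x k by case: xs => /(_ k)/andP[].
pose P k := 0 < v k; pose S := \sum_(k | P k) `|v k|.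
have SE : \sum_(k | ~~ P k) `|v k| = S.
  move: v0; rewrite (bigID P)/= => /eqP; rewrite addr_eq0 => /eqP vE.
  have -> : S = \sum_(k | P k) v k by apply: eq_bigr => k /gtr0_norm.
  rewrite vE -sumrN.
  by apply: eq_bigr => k; rewrite -leNgt => /ler0_norm.
have nE : norm1 v = 2 * S.
  by rewrite /norm1 (bigID P)/= SE -/S mulr_natl mulr2n.
have S0 : 0 <= S by apply: sumr_ge0 => k _.
have [S0'|Sn0] := eqVneq S 0.
  rewrite nE S0' mulr0 expr0n mulr0; apply: sumr_ge0 => k _.
  by rewrite mulr_ge0 ?powR_ge0// sqr_ge0.
have exP : exists k, P k.
  apply/not_existsP => nP; move/eqP: Sn0; apply; apply: big_pred0 => k.
  by apply/negP; exact: nP.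
have exN : exists k, ~~ P k.
  apply/not_existsP => nP; move/eqP: Sn0; apply; rewrite -SE.
  by apply: big_pred0 => k; apply/negbTE/negP; exact: nP.
have hP := hess_partition v x0 exP; have hN := hess_partition v x0 exN.
rewrite SE -/S in hP hN.
rewrite /hess [leRHS](bigID P)/= nE; apply: le_trans (lerD hP hN).
have -> : C * (2 * S) ^+ 2 = S ^+ 2 * (4 * C) by ring.
by rewrite -mulrDr ler_wpM2l ?sqr_ge0// HC.
Qed.

Lemma hess_bound_le1 : a <= 1 -> hess_bound K a (2 `^ (1 - a)).
Proof.
move=> a1; apply: hess_bound_of_partition => x P [x01 x1] exP exN.
have x0 k : 0 < x k by case/andP: (x01 k).
have s1 : 1 <= 2 - a by lra.
have part (Q : pred 'I_K) : (exists k, Q k) ->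
    (\sum_(k | Q k) x k) `^ (a - 2) <= (\sum_(k | Q k) x k `^ (2 - a))^-1.
  move=> exQ; rewrite -[a - 2]opprB powRN lef_pV2 ?posrE.
  - exact: sum_powR_le.
  - by rewrite powR_gt0// sum_gt0.
  - by apply: sum_gt0 => // k; rewrite powR_gt0.
apply: le_trans (lerD (part _ exP) (part _ exN)).
rewrite -powR2_quadruple; apply: le_sum_powR_half; rewrite ?sum_gt0//; first by left; lra.
by rewrite -x1 [RHS](bigID P).
Qed.

End LowerBounds.

(** * The lower bound for [1 < a <= 2]: balanced splits and the parity of [K] *)

Section Middle.
Variables (R : realType).
Implicit Types (a b x y : R).

(** Spreading a pair of fixed sum increases a convex function. Since [y - d = c - x], the tangents
    at [c] and [d] leave [(c - x)] times a difference of slopes, which is nonnegative. *)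
Lemma powR_balanced_le b x y c d : b <= 0 -> 0 < x -> x <= c -> c <= d ->
  x + y = c + d -> c `^ b + d `^ b <= x `^ b + y `^ b.
Proof.
move=> b0 x0 xc cd xy.
have hb : b <= 0 \/ 1 <= b by left.
have c0 : 0 < c by lra. have d0 : 0 < d by lra. have y0 : 0 < y by lra.
have hx := powR_tangent_convex hb x0 c0.
have hy := powR_tangent_convex hb y0 d0.
have slope : d `^ (b - 1) <= c `^ (b - 1).
  rewrite -opprB !powRN lef_pV2 ?posrE ?powR_gt0//.
  by apply: ge0_ler_powR; rewrite ?nnegrE ?(ltW c0) ?(ltW d0)//; lra.
have : 0 <= (c - x) * (b * (d `^ (b - 1) - c `^ (b - 1))).
  by rewrite mulr_ge0 ?subr_ge0// mulr_le0// subr_le0.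
have -> : (c - x) * (b * (d `^ (b - 1) - c `^ (b - 1))) =
  b * c `^ (b - 1) * (x - c) + b * d `^ (b - 1) * (y - d).
  have -> : y = c + d - x by lra.
  by ring.
lra.
Qed.

(** For [b <= 0] and [K >= 2], the minimum of [m^b + n^b] over positive integers with
    [m + n = K]. *)
Definition balanced_powR_sum b (K : nat) : R := K./2%:R `^ b + (K - K./2)%:R `^ b.

Lemma balanced_powR_sum_le b (m n : nat) : b <= 0 -> (0 < m)%N -> (0 < n)%N ->
  balanced_powR_sum b (m + n) <= m%:R `^ b + n%:R `^ b.
Proof.
move=> b0; wlog mn : m n / (m <= n)%N.
  move=> H m0 n0; case/orP: (leq_total m n) => [|nm]; first by move/H; apply.
  by rewrite addnC addrC; apply: H.
move=> m0 n0; apply: powR_balanced_le => //; rewrite ?ltr0n ?ler_nat; try lia.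
by rewrite -!natrD; congr (_%:R); lia.
Qed.

Lemma balanced_powR_sum_gt0 b (K : nat) : (2 <= K)%N -> 0 < balanced_powR_sum b K.
Proof. by move=> K2; rewrite addr_gt0// powR_gt0// ltr0n; lia. Qed.

(** One formula for both parities. For odd [K] the parts are [(K/2)(1 - 1/K)] and [(K/2)(1 + 1/K)],
    so pulling out [K/2] leaves exactly the mean inside [sigma_const]; for even [K] that mean is
    replaced by 1. *)
Lemma C_value_middle a (K : nat) : 1 < a <= 2 -> (2 <= K)%N ->
  4 * C_value a K = balanced_powR_sum ((1 - a) / (3 - a)) K `^ (3 - a).
Proof.
move=> /andP[a1 a2] K2; rewrite /C_value leNgt a1/= a2.
have K0 : 0 < K%:R :> R by rewrite ltr0n; lia.
have a3 : 3 - a != 0 by lra.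
set b := (1 - a) / (3 - a).
have bE : b * (3 - a) = 1 - a by rewrite /b divfK.
have pow2 : (2 : R) `^ (3 - a) = 4 * (2 `^ (1 - a)).
  by rewrite -powR2_quadruple; congr (_ `^ _); lra.
have powK2 : (K%:R / 2 : R) `^ (1 - a) * 2 `^ (1 - a) = K%:R `^ (1 - a).
  by rewrite -powRM ?divfK// ?divr_ge0 ?ler0n.
have K20 : 0 <= K%:R / 2 :> R by rewrite divr_ge0.
case: ifPn => Kodd.
  have hK : K = (K./2.*2.+1)%N by lia.
  have iK : 0 <= 1 - K%:R^-1 :> R by rewrite subr_ge0 invf_le1// ler1n; lia.
  have iK' : 0 <= 1 + K%:R^-1 :> R by rewrite addr_ge0// invr_ge0.
  have lo : (K./2)%:R = (K%:R / 2) * (1 - K%:R^-1) :> R.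
    have : K%:R = (K./2)%:R * 2 + 1 :> R.
      by rewrite {1}hK -addn1 -muln2 natrD natrM.
    move=> KE; have -> : K./2%:R = (K%:R - 1) / 2 :> R by rewrite KE; field.
    by field; rewrite gt_eqF.
  have hi : (K - K./2)%:R = (K%:R / 2) * (1 + K%:R^-1) :> R.
    rewrite natrB; last by lia.
    by rewrite lo; field; rewrite gt_eqF.
  rewrite /balanced_powR_sum lo hi /sigma_const -/b.
  rewrite (powRM _ K20 iK) (powRM _ K20 iK') -mulrDr.
  set s := (1 - K%:R^-1) `^ b + _.
  have s0 : 0 <= s by rewrite addr_ge0 ?powR_ge0.
  have -> : (K%:R / 2) `^ b * s = (K%:R / 2) `^ b * (2 * (s / 2)) by field.
  have s20 : 0 <= s / 2 by rewrite divr_ge0.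
  have two0 : 0 <= 2 :> R by [].
  rewrite [RHS]powRM ?powR_ge0 ?mulr_ge0// -powRrM bE.
  rewrite (powRM _ two0 s20) pow2 -powK2.
  by ring.
have hK : K = (K./2.*2)%N by lia.
have lo : (K./2)%:R = K%:R / 2 :> R.
  by rewrite {2}hK -muln2 natrM mulfK.
have -> : balanced_powR_sum b K = (K%:R / 2) `^ b * 2.
  rewrite /balanced_powR_sum natrB; last by lia.
  have -> : K%:R - K./2%:R = K%:R / 2 :> R by rewrite lo; field.
  by rewrite lo; ring.
by rewrite [RHS]powRM ?powR_ge0// -powRrM bE pow2 -powK2; ring.
Qed.

Lemma hess_bound_middle a (K : nat) : 1 < a <= 2 -> (2 <= K)%N ->
  hess_bound K a (C_value a K).
Proof.
move=> /andP[a1 a2] K2; apply: hess_bound_of_partition => x P [x01 x1] exP exN.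
rewrite C_value_middle ?a1//.
have x0 k : 0 < x k by case/andP: (x01 k).
have s01 : 0 <= 2 - a <= 1 by apply/andP; split; lra.
set b := (1 - a) / (3 - a).
have bE : b * (3 - a) = 1 - a by rewrite /b divfK//; lra.
have b0 : b <= 0 by apply: mulr_le0_ge0; [lra | rewrite invr_ge0; lra].
have card_pos (Q : pred 'I_K) : (exists k, Q k) -> (0 < #|Q|)%N.
  by move=> [k Qk]; apply/card_gt0P; exists k.
(* Concavity gives the bound [m^(1-a) * X^(a-2)] for a part of size [m] and mass [X]. It is written
   with [m^b] so that it matches [radon_powR] with [r = 3 - a], which then eliminates the masses. *)
have part (Q : pred 'I_K) : (exists k, Q k) ->
    (#|Q|%:R `^ b) `^ (3 - a) * (\sum_(k | Q k) x k) `^ (1 - (3 - a))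
      <= (\sum_(k | Q k) x k `^ (2 - a))^-1.
  move=> exQ.
  have -> : 1 - (3 - a) = - (2 - a) by lra.
  rewrite -powRrM bE -opprB !powRN -invfM lef_pV2 ?posrE.
  - have -> : a - 1 = 1 - (2 - a) by lra.
    exact: sum_powR_card_le.
  - by rewrite mulr_gt0// powR_gt0 ?sum_gt0// ltr0n card_pos.
  - by apply: sum_gt0 => // k; rewrite powR_gt0.
apply: le_trans (lerD (part _ exP) (part _ exN)).
have X0 := sum_gt0 x0 exP; have Y0 := sum_gt0 x0 exN.
have XY : \sum_(k | P k) x k + \sum_(k | ~~ P k) x k = 1.
  by rewrite -x1 [RHS](bigID P).
have A0 : 0 < #|P|%:R `^ b :> R by rewrite powR_gt0// ltr0n card_pos.
have B0 : 0 < #|[predC P]|%:R `^ b :> R by rewrite powR_gt0// ltr0n card_pos.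
have a3 : 1 <= 3 - a by lra.
apply: le_trans (radon_powR a3 X0 Y0 XY A0 B0).
apply: ge0_ler_powR; rewrite ?nnegrE.
- by lra.
- by rewrite ltW// balanced_powR_sum_gt0.
- by rewrite ltW// addr_gt0.
- have {1}-> : K = (#|P| + #|[predC P]|)%N by rewrite cardC card_ord.
  by apply: balanced_powR_sum_le; rewrite // card_pos.
Qed.

End Middle.

(** * The case [K = 2], [a > 2], and test points showing that the constants are sharp *)

Section Sharpness.
Variables (R : realType).
Implicit Types (a b x y z C : R).

(** Here [v] is a multiple of [(1, -1)], leaving [x^(a-2) + y^(a-2)] with [x + y = 1]. For [a >= 3]
    convexity puts the minimum at [1/2]; for [a < 3], [t^(a-2) >= t] on the unit interval bounds the
    sum below by 1. *)
Lemma hess_bound_two a : 2 < a -> hess_bound 2 a (2 `^ (1 - Num.max a 3)).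
Proof.
move=> a2 x v [x01 x1] v0.
move: x1 v0; rewrite /norm1 /hess !big_ord_recl !big_ord0 !addr0.
have := x01 ord0; have := x01 (lift ord0 ord0).
move: (x _) (x _) (v _) (v _) => x_1 x_0 v_1 v_0.
move=> /andP[x10 x11] /andP[x00 x01'] xs vs.
have -> : v_0 = - v_1 by lra.
rewrite normrN sqrrN -mulrDl -[v_1 ^+ 2]real_normK ?num_real//.
have -> c (t : R) : c * (t + t) ^+ 2 = 4 * c * t ^+ 2 by ring.
rewrite ler_wpM2r ?sqr_ge0//.
have [a3|a3] := leP 3 a.
  rewrite -powR2_quadruple; apply: le_sum_powR_half => //.
  by right; lra.
have -> : 1 - 3 = - 2 :> R by lra.
have -> : 4 * 2 `^ (- 2) = 1 :> R by rewrite powRN powR_mulrn//; field.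
rewrite -xs.
by apply: lerD; apply: ger1_powR; rewrite ?x00 ?x10/= ?ltW//; lra.
Qed.

Lemma relint_simplex_of_gt0 (K : nat) (x : 'I_K -> R) : (2 <= K)%N ->
  (forall k, 0 < x k) -> \sum_(k < K) x k = 1 -> relint_simplex x.
Proof.
move=> K2 x0 x1; split=> // k; rewrite x0/= -x1 (bigD1 k)//= ltrDl.
apply: sum_gt0 => //.
have K0 : (0 < K)%N by lia.
have [k0|k0] := eqVneq (val k) 0.
  by exists (Ordinal K2); rewrite -val_eqE/= k0.
by exists (Ordinal K0); rewrite -val_eqE/= eq_sym.
Qed.

(** Tests the direction [(1, -1, 0, ..., 0)] at [(y, z, w, ..., w)]. For [n = 0] the value [w] does
    not occur in the point, so any positive number can be supplied. *)
Lemma hess_bound_pair n a C y z w : hess_bound n.+2 a C ->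
  0 < y -> 0 < z -> 0 < w -> y + z + n%:R * w = 1 ->
  4 * C <= y `^ (a - 2) + z `^ (a - 2).
Proof.
move=> HC y0 z0 w0 yzw.
(* The defaults of [nth], [w] here and 0 in [v], give the values at all indices from 2 on. *)
pose x (k : 'I_n.+2) := nth w [:: y; z] k.
pose v (k : 'I_n.+2) := nth (0 : R) [:: 1; -1] k.
have x0 k : 0 < x k by case: k => -[|[|k]] ? //=; rewrite /x/= nth_nil.
have xs : relint_simplex x.
  apply: relint_simplex_of_gt0 => //.
  rewrite !big_ord_recl (eq_bigr (fun=> w)) => [|k _]; last by rewrite /x/= nth_nil.
  by rewrite sumr_const card_ord /x/= addrA -[w *+ n]mulr_natl.
have sum2 (F : 'I_n.+2 -> R) : (forall k, v k = 0 -> F k = 0) ->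
    \sum_k F k = F ord0 + F (lift ord0 ord0).
  move=> F0; rewrite !big_ord_recl big1 ?addr0// => k _.
  by apply: F0; rewrite /v/= nth_nil.
have v0 : \sum_k v k = 0 by rewrite sum2// /v/= subrr.
have := HC x v xs v0.
rewrite /norm1 /hess !sum2 => [|k ->|k ->]; last 2 first.
- by rewrite expr0n mulr0.
- by rewrite normr0.
by rewrite /x /v/= normrN normr1 sqrrN expr1n !mulr1; lra.
Qed.

(** Tests blocks of sizes [m] and [n] on which [x] and [v] are constant, the equality case of
    Cauchy-Schwarz and of the power-mean bound on each part. *)
Lemma hess_bound_split m n a C X Y : hess_bound (m + n) a C ->
  (0 < m)%N -> (0 < n)%N -> 0 < X -> 0 < Y -> X + Y = 1 ->
  4 * C <= m%:R `^ (1 - a) * X `^ (a - 2) + n%:R `^ (1 - a) * Y `^ (a - 2).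
Proof.
move=> HC m0 n0 X0 Y0 XY.
have m0' : 0 < m%:R :> R by rewrite ltr0n.
have n0' : 0 < n%:R :> R by rewrite ltr0n.
pose x (k : 'I_(m + n)) := if (k < m)%N then X / m%:R else Y / n%:R.
pose v (k : 'I_(m + n)) := if (k < m)%N then m%:R^-1 else - n%:R^-1 : R.
have sumE (F : 'I_(m + n) -> R) (c d : R) :
    (forall k, F k = if (k < m)%N then c else d) ->
    \sum_(k < m + n) F k = m%:R * c + n%:R * d.
  move=> FE; rewrite big_split_ord/=; congr (_ + _).
    rewrite (eq_bigr (fun=> c)) => [|k _]; last by rewrite FE/= ltn_ord.
    by rewrite sumr_const card_ord mulr_natl.
  rewrite (eq_bigr (fun=> d)) => [|k _]; last by rewrite FE/= ltnNge leq_addr.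
  by rewrite sumr_const card_ord mulr_natl.
have xs : relint_simplex x.
  apply: relint_simplex_of_gt0 => [|k|]; first by lia.
    by rewrite /x; case: ifP => _; rewrite divr_gt0.
  by rewrite (sumE _ (X / m%:R) (Y / n%:R))// ![_ * (_ / _)]mulrC !divfK ?gt_eqF.
have v0 : \sum_k v k = 0.
  by rewrite (sumE _ m%:R^-1 (- n%:R^-1))// mulrN !divff ?gt_eqF// subrr.
have := HC x v xs v0.
rewrite /norm1 (sumE _ m%:R^-1 n%:R^-1) => [|k]; last first.
  by rewrite /v; case: ifP => _; rewrite ?normrN gtr0_norm ?invr_gt0.
rewrite /hess (sumE _ ((X / m%:R) `^ (a - 2) * m%:R^-1 ^+ 2)
  ((Y / n%:R) `^ (a - 2) * n%:R^-1 ^+ 2)) => [|k]; last first.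
  by rewrite /x /v; case: ifP => _; rewrite ?sqrrN.
rewrite !divff ?gt_eqF//.
have scale (p Z : R) : 0 < p -> 0 < Z ->
    p * ((Z / p) `^ (a - 2) * p^-1 ^+ 2) = p `^ (1 - a) * Z `^ (a - 2).
  move=> p0 Z0; rewrite powRM ?invr_ge0 ?(ltW p0) ?(ltW Z0)//.
  have -> : p `^ (1 - a) = p^-1 * p^-1 `^ (a - 2).
    rewrite -[p^-1](powR_inv1 (ltW p0)) -powRrM mulN1r -powRD.
      by congr (_ `^ _); lra.
    by rewrite (gt_eqF p0) implybT.
  by field; rewrite gt_eqF.
rewrite !scale//; have -> // : C * (1 + 1) ^+ 2 = 4 * C by ring.
Qed.

Lemma small_powR r (e : R) : 0 < r -> 0 < e ->
  exists2 y, 0 < y < 2^-1 & y `^ r <= e.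
Proof.
(* The cap [1/4] keeps [y] strictly below [1/2], so that mass [1 - 2 * y > 0] remains for other
   coordinates. *)
move=> r0 e0; pose y := Num.min 4^-1 (e `^ r^-1).
have y0 : 0 < y by rewrite lt_min powR_gt0// andbT invr_gt0.
have y4 : y <= 4^-1 by rewrite ge_min lexx.
exists y; first by apply/andP; split=> //; lra.
have -> : e = (e `^ r^-1) `^ r by rewrite -powRrM mulVf ?gt_eqF// powRr1// ltW.
apply: ge0_ler_powR; rewrite ?nnegrE ?powR_ge0//; [exact: ltW|exact: ltW|].
by rewrite ge_min lexx orbT.
Qed.

Lemma hess_bound_ub_le1 n a C : a <= 1 -> hess_bound n.+2 a C -> C <= 2 `^ (1 - a).
Proof.
move=> a1 HC; rewrite leNgt; apply/negP => ltC.
have h0 : 0 < 2^-1 :> R by rewrite invr_gt0.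
have halfE := powR_half_double (a - 2); rewrite powR2_quadruple in halfE.
case: n => [|n] in HC.
  have := hess_bound_pair HC h0 h0 ltr01; rewrite halfE mul0r addr0.
  have -> : 2^-1 + 2^-1 = 1 :> R by lra.
  by move=> /(_ erefl); lra.
set C0 := 2 `^ (1 - a) in ltC halfE.
have C00 : 0 < C0 by rewrite powR_gt0.
have a20 : a - 2 != 0 by lra.
(* Chosen so that [y^(a-2) = C + C0]. This exceeds [2 * C0 = (1/2)^(a-2)], forcing [y < 1/2], while
   the pair [(y, y)] gives [4 * C <= 2 * (C + C0)], contradicting [C0 < C]. *)
pose y := (C + C0) `^ (a - 2)^-1.
have y0 : 0 < y by rewrite powR_gt0; lra.
have yE : y `^ (a - 2) = C + C0 by rewrite -powRrM mulVf// powRr1//; lra.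
have yh : y < 2^-1.
  rewrite ltNge; apply/negP => hy.
  have : y `^ (a - 2) <= 2^-1 `^ (a - 2).
    rewrite -[a - 2]opprB !powRN lef_pV2 ?posrE ?(powR_gt0 _ y0) ?(powR_gt0 _ h0)//.
    by apply: ge0_ler_powR; rewrite ?nnegrE ?(ltW y0) ?(ltW h0)//; lra.
  by rewrite yE; lra.
have n0 : 0 < n.+1%:R :> R by rewrite ltr0n.
have w0 : 0 < (1 - 2 * y) / n.+1%:R by rewrite divr_gt0//; lra.
have := hess_bound_pair HC y0 y0 w0; rewrite yE [n.+1%:R * _]mulrC divfK ?gt_eqF//.
have -> : y + y + (1 - 2 * y) = 1 by lra.
by move=> /(_ erefl); lra.
Qed.

Lemma hess_bound_ub_middle (K : nat) a C : 1 < a <= 2 -> (2 <= K)%N ->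
  hess_bound K a C -> C <= C_value a K.
Proof.
move=> a12 K2; rewrite -(ler_pM2l (ltr0n R 4)) C_value_middle//.
have /andP[a1 a2] := a12.
set b := (1 - a) / (3 - a); rewrite /balanced_powR_sum.
have bE : b * (3 - a) = 1 - a by rewrite /b divfK//; lra.
have halfK : (K./2 <= K)%N by lia.
have m0 : (0 < K./2)%N by lia.
have n0 : (0 < K - K./2)%N by lia.
rewrite -{1}(subnKC halfK).
move: (K./2) (K - K./2)%N m0 n0 => m n m0 n0 HC.
have A0 : 0 < m%:R `^ b :> R by rewrite powR_gt0// ltr0n.
have B0 : 0 < n%:R `^ b :> R by rewrite powR_gt0// ltr0n.
have := hess_bound_split HC m0 n0.
rewrite -bE (powRrM _ b) (powRrM _ b); move: (m%:R `^ b) (n%:R `^ b) A0 B0 => A B A0 B0 HAB.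
have AB0 : 0 < A + B by rewrite addr_gt0.
(* The masses [A / (A + B)] and [B / (A + B)] are the equality case of [radon_powR]; the two terms
   add up to [(A + B)^(3-a)]. *)
have term D : 0 < D ->
    D `^ (3 - a) * (D / (A + B)) `^ (a - 2) = D * (A + B) `^ (2 - a).
  move=> D0; rewrite powRM ?invr_ge0 ?(ltW D0) ?(ltW AB0)//.
  rewrite -[(A + B)^-1](powR_inv1 (ltW AB0)) -powRrM mulN1r opprB mulrA.
  rewrite -powRD ?(gt_eqF D0) ?implybT//.
  have -> : 3 - a + (a - 2) = 1 by lra.
  by rewrite powRr1 ?ltW.
have AB1 : A / (A + B) + B / (A + B) = 1 by rewrite -mulrDl divff ?gt_eqF.
have := HAB _ _ (divr_gt0 A0 AB0) (divr_gt0 B0 AB0) AB1.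
rewrite !term// -mulrDl -{1}(powRr1 (ltW AB0)) -powRD ?(gt_eqF AB0) ?implybT//.
by have -> : 1 + (2 - a) = 3 - a by lra.
Qed.

Lemma hess_bound_ub_two a C : 2 < a -> hess_bound 2 a C ->
  C <= 2 `^ (1 - Num.max a 3).
Proof.
move=> a2 HC; have h0 : 0 < 2^-1 :> R by rewrite invr_gt0.
have [a3|a3] := leP 3 a.
  have := hess_bound_pair HC h0 h0 ltr01; rewrite powR_half_double mul0r addr0.
  have -> : 2^-1 + 2^-1 = 1 :> R by lra.
  by rewrite powR2_quadruple ler_pM2l//; apply.
have -> : 1 - 3 = - 2 :> R by lra.
rewrite powRN powR_mulrn// leNgt; apply/negP => ltC.
have a20 : 0 < a - 2 by lra.
(* Half of the gap between [4 * C] and 1, the limit of [y^(a-2) + (1-y)^(a-2)] as [y] tends to 0. *)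
have e0 : 0 < (4 * C - 1) / 2 by lra.
have [y /andP[y0 yh] ye] := small_powR a20 e0.
have z0 : 0 < 1 - y by lra.
have z1 : (1 - y) `^ (a - 2) <= 1.
  have one : 1 `^ (a - 2) = 1 :> R by rewrite powR1.
  rewrite -[leRHS]one.
  by apply: ge0_ler_powR; rewrite ?nnegrE; lra.
have := hess_bound_pair HC y0 z0 ltr01; rewrite mul0r addr0 subrKC.
by move=> /(_ erefl); lra.
Qed.

(** With a third coordinate to absorb the mass, both entries of the tested pair can be tiny:
    [y^(a-2) <= C] gives [4 * C <= 2 * C]. *)
Lemma hess_bound_ub_gt2 n a C : 2 < a -> hess_bound n.+3 a C -> C <= 0.
Proof.
move=> a2 HC; rewrite leNgt; apply/negP => C0.
have a20 : 0 < a - 2 by lra.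
have [y /andP[y0 yh] yC] := small_powR a20 C0.
have n0 : 0 < n.+1%:R :> R by rewrite ltr0n.
have w0 : 0 < (1 - 2 * y) / n.+1%:R by rewrite divr_gt0//; lra.
have := hess_bound_pair HC y0 y0 w0; rewrite [n.+1%:R * _]mulrC divfK ?gt_eqF//.
have -> : y + y + (1 - 2 * y) = 1 by lra.
by move=> /(_ erefl); lra.
Qed.

End Sharpness.

(* C_value a K is the largest admissible constant *)
Theorem theorem1 (R : realType) (K : nat) (a : R) (hK : (2 <= K)%N) :
  admissible_const K a (C_value a K) /\
  (forall C : R, admissible_const K a C -> C <= C_value a K).
Proof.
suff [C0 HC maxC] : [/\ 0 <= C_value a K, hess_bound K a (C_value a K) &
    forall C, 0 <= C -> hess_bound K a C -> C <= C_value a K].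
  split; first exact: admissible_of_hess_bound.
  by move=> C HCa; apply: maxC; [case: HCa | exact: hess_bound_of_admissible].
have [a1|a1] := leP a 1.
  rewrite /C_value a1; split; [exact: powR_ge0 | exact: hess_bound_le1 |].
  case: K hK => [|[|n]]// _ C _; exact: hess_bound_ub_le1.
have [a2|a2] := leP a 2.
  have a12 : 1 < a <= 2 by rewrite a1.
  split; [|exact: hess_bound_middle | by move=> C _; exact: hess_bound_ub_middle].
  by rewrite -(pmulr_rge0 _ (ltr0n R 4)) C_value_middle// powR_ge0.
rewrite /C_value (leNgt a 1) (leNgt a 2) a1 a2/=.
case: K hK => [|[|[|n]]]// _.
  split; [exact: powR_ge0 | exact: hess_bound_two |].
  by move=> C _; exact: hess_bound_ub_two.
split=> // [x v _ _|C _]; last exact: hess_bound_ub_gt2.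
rewrite mul0r; apply: sumr_ge0 => k _.
by rewrite mulr_ge0 ?powR_ge0 ?sqr_ge0.
Qed.
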